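(* For every integer $C\geq 2$ there exist a constant $K_C$ (depending only on $C$) and $r_0$ such that for all integers $r\geq r_0$ and $\rho\geq 2$ there exist trees $T$ and $\mathcal{T}$ such that: (1) $\Delta(T)\leq\rho+3$ and $\Delta(\mathcal{T})\leq 3^{C+1}+2$; (2) $T$ is an $n$-vertex tree with bipartition class sizes $t_1,t_2$ satisfying $|t_1-3^C\rho r|\leq K_C$ and $|t_2-3^Cr|\leq K_C$; (3) $\mathcal{T}$ is a $\nu$-vertex tree with bipartition class sizes $\tau_1,\tau_2$ satisfying $|\tau_1-((3^C-3)\rho r+(3^C+3)r)/2|\leq K_C$ and $|\tau_2-3(\rho-1)r|\leq K_C$, and such that $2\nu=n+\tau_2<2t_1$; (4) $R(T,\mathcal{T})\geq 2\nu+C-2=\underline{R}(T,\mathcal{T})+C-1$.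
   Context: For graphs $G_1,G_2$, $R(G_1,G_2)$ is the smallest positive integer $N$ such that every red/blue colouring of the edges of $K_N$ contains a red copy of $G_1$ or a blue copy of $G_2$. For an $n$-vertex tree $T$ with bipartition class sizes $t_1\geq t_2$ and a $\nu$-vertex tree $\mathcal{T}$ with bipartition class sizes $\tau_1\geq\tau_2$, where $n\geq\nu$, define $\underline{R}(T,\mathcal{T})=\max\{n+\tau_2,\nu+\min\{t_2,\nu\},\min\{2t_1,2\nu\},2\tau_1\}-1$. $\Delta$ denotes maximum degree. (The paper writes the size conditions in (2),(3) with $O_C(1)$ error terms, i.e. errors bounded by a constant depending only on $C$.) *)

(* Defs.v *)
From HB Require Import structures.
From mathcomp Require Import all_boot all_order all_algebra.

Set Implicit Arguments.
Unset Strict Implicit.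
Unset Printing Implicit Defensive.

Record sgraph := SGraph {
  vertex :> finType;
  adj : rel vertex;
  adj_sym : symmetric adj;
  adj_irr : irreflexive adj
}.

Definition max_degree (G : sgraph) : nat :=
  \max_(x : G) #|[set y | @adj G x y]|.

Definition connected_graph (G : sgraph) : Prop :=
  forall x y : G, connect (@adj G) x y.

(* [ucycle] also accepts sequences of length 0 and 2 (an edge traversed back
   and forth), which are not cycles of a simple graph. *)
Definition acyclic_graph (G : sgraph) : Prop :=
  forall s : seq G, ucycle (@adj G) s -> size s <= 2.

Definition is_tree (G : sgraph) : Prop :=
  [/\ 0 < #|G|, connected_graph G & acyclic_graph G].

Definition bipartition_sizes (G : sgraph) (m1 m2 : nat) : Prop :=
  exists A : {set G},
    [/\ forall x y : G, adj x y -> (x \in A) != (y \in A),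
        #|A| = m1, #|~: A| = m2 & m2 <= m1].

(* A copy is a subgraph, not necessarily induced. *)
Definition has_copy (G : sgraph) (V : finType) (e : rel V) : bool :=
  [exists f : {ffun G -> V},
    injectiveb f && [forall x, forall y, adj x y ==> e (f x) (f y)]].

(* A colouring of the edges of K_N is a symmetric function of two vertices,
   [true] being red; its values on the diagonal are irrelevant, because the
   vertices of a copy are distinct. *)
Definition arrows (N : nat) (G1 G2 : sgraph) : bool :=
  [forall c : {ffun 'I_N * 'I_N -> bool},
    [forall x, forall y, c (x, y) == c (y, x)] ==>
      has_copy G1 [rel x y | c (x, y)] ||
      has_copy G2 [rel x y | ~~ c (x, y)]].

Definition clique_in (V : finType) (e : rel V) (A : {set V}) : Prop :=
  {in A &, forall x y, x != y -> e x y}.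

Lemma ramsey_cliques (a b : nat) : exists N, forall (V : finType) (e : rel V),
  symmetric e -> forall S : {set V}, N <= #|S| ->
    exists2 A : {set V}, A \subset S &
      (#|A| = a /\ clique_in e A) \/
      (#|A| = b /\ clique_in [rel x y | ~~ e x y] A).
Proof.
move: {2}(a + b) (erefl (a + b)) => k; elim: k a b => [|k IH] a b.
  move/eqP; rewrite addn_eq0 => /andP[/eqP-> _].
  exists 0 => V e _ S _; exists set0; first exact: sub0set.
  by left; split; [rewrite cards0 | move=> x y; rewrite inE].
case: a => [|a].
  move=> _; exists 0 => V e _ S _; exists set0; first exact: sub0set.
  by left; split; [rewrite cards0 | move=> x y; rewrite inE].
case: b => [|b].
  move=> _; exists 0 => V e _ S _; exists set0; first exact: sub0set.
  by right; split; [rewrite cards0 | move=> x y; rewrite inE].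
move=> abk.
have [N1 H1] : exists N, forall (V : finType) (e : rel V),
    symmetric e -> forall S : {set V}, N <= #|S| ->
    exists2 A : {set V}, A \subset S &
      (#|A| = a /\ clique_in e A) \/
      (#|A| = b.+1 /\ clique_in [rel x y | ~~ e x y] A).
  by apply: IH; case: abk.
have [N2 H2] : exists N, forall (V : finType) (e : rel V),
    symmetric e -> forall S : {set V}, N <= #|S| ->
    exists2 A : {set V}, A \subset S &
      (#|A| = a.+1 /\ clique_in e A) \/
      (#|A| = b /\ clique_in [rel x y | ~~ e x y] A).
  by apply: IH; case: abk; rewrite addnS addSn.
exists (N1 + N2).+1 => V e esym S leS.
have /card_gt0P[x xS] : 0 < #|S| by apply: leq_trans leS.
have cliqueU (r : rel V) (B : {set V}) : symmetric r ->
    {in B, forall y, r x y} -> clique_in r B -> clique_in r (x |: B).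
  move=> rsym rx cB y z; rewrite !inE => /predU1P[->|yB] /predU1P[->|zB].
  - by rewrite eqxx.
  - by move=> _; apply: rx.
  - by move=> _; rewrite rsym; apply: rx.
  - exact: cB.
have nesym : symmetric [rel y z | ~~ e y z] by move=> y z /=; rewrite esym.
have leD : N1 + N2 <= #|S :\ x| by move: leS; rewrite (cardsD1 x) xS.
rewrite -(cardsID [set y | e x y]) in leD.
set S1 := _ :&: _ in leD; set S2 := _ :\: _ in leD.
have S1S : S1 \subset S by rewrite subIset // subD1set.
have S2S : S2 \subset S by rewrite subDset subsetU // subD1set orbT.
have xS1 : x \notin S1 by rewrite !inE eqxx.
have xS2 : x \notin S2 by rewrite !inE eqxx andbF.
have subU (B S' : {set V}) : B \subset S' -> S' \subset S ->
    x |: B \subset S.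
  by move=> BS S'S; rewrite subUset sub1set xS (subset_trans BS).
have cardU (B S' : {set V}) : B \subset S' -> x \notin S' ->
    #|x |: B| = #|B|.+1.
  by move=> BS xS'; rewrite cardsU1 (contra (subsetP BS x)).
have [le1|lt1] := leqP N1 #|S1|.
  have [A AS1 [[cA qA]|[cA qA]]] := H1 V e esym S1 le1.
    exists (x |: A); first exact: subU AS1 S1S.
    left; split; first by rewrite (cardU _ _ AS1) ?cA.
    by apply: cliqueU => // y /(subsetP AS1); rewrite !inE => /andP[].
  by exists A; [exact: subset_trans AS1 S1S | right].
have le2 : N2 <= #|S2|.
  rewrite -(leq_add2l N1); apply: leq_trans leD _.
  by rewrite leq_add2r ltnW.
have [A AS2 [[cA qA]|[cA qA]]] := H2 V e esym S2 le2.
  by exists A; [exact: subset_trans AS2 S2S | left].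
exists (x |: A); first exact: subU AS2 S2S.
right; split; first by rewrite (cardU _ _ AS2) ?cA.
by apply: cliqueU => // y /(subsetP AS2); rewrite !inE => /andP[].
Qed.

Lemma clique_has_copy (G : sgraph) (V : finType) (e : rel V) (A : {set V}) :
  #|A| = #|G| -> clique_in e A -> has_copy G e.
Proof.
move=> cA qA.
pose f := [ffun x : G => enum_val (cast_ord (esym cA) (enum_rank x))].
have finj : injective f.
  by move=> x y; rewrite !ffunE => /enum_val_inj/cast_ord_inj/enum_rank_inj.
apply/existsP; exists f; apply/andP; split; first exact/injectiveP.
apply/forallP => x; apply/forallP => y; apply/implyP => xy.
apply: qA; rewrite ?(inj_eq finj); try by rewrite ffunE enum_valP.
by apply: contraTneq xy => ->; rewrite adj_irr.
Qed.

Lemma ramsey_exists (G1 G2 : sgraph) :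
  exists N, (0 < N) && arrows N G1 G2.
Proof.
have [N HN] := ramsey_cliques #|G1| #|G2|.
exists N.+1; apply/forallP => c; apply/implyP => /forallP csym.
have rsym : symmetric [rel x y | c (x, y)].
  by move=> x y; apply/eqP; apply: (forallP (csym x)).
have leN : N <= #|[set: 'I_N.+1]| by rewrite cardsT card_ord.
have [A _ [[cA qA]|[cA qA]]] := HN _ _ rsym _ leN.
  by rewrite (clique_has_copy cA qA).
by rewrite (clique_has_copy cA qA) orbT.
Qed.

Definition ramsey (G1 G2 : sgraph) : nat := ex_minn (ramsey_exists G1 G2).

Definition ramsey_lower (n t1 t2 nu tau1 tau2 : nat) : nat :=
  maxn (n + tau2)
    (maxn (nu + minn t2 nu) (maxn (minn (2 * t1) (2 * nu)) (2 * tau1))) - 1.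

(* Main.v *)
(** The colouring on [2 * nu + C - 3] vertices has two parts of size [nu - 1]
    and one part [Z] of size [C - 1]; an edge is blue iff it lies inside a part.
    Blue components have fewer than [nu] vertices, so there is no blue copy of
    any [nu]-vertex tree.  A red copy of [T] would give a set of at most [C - 1]
    vertices whose removal lets the remaining components be flipped so that
    both sides have at most [nu - 1] vertices, hence differ by at most about
    [tau2], which is about [3 * (rho - 1) * r].

    [T] is a ternary tree of depth [C] whose [3 ^ C] leaves are replaced by
    caterpillars of imbalance [(rho - 1) * r].  Deleting a vertex at height [j]
    changes the imbalance by at most [2 * 3 ^ j] of these units, while at a
    height [L] without deleted vertices the imbalance is an odd multiple of
    [3 ^ L] units up to deletions below.  For a suitable [L] this leaves at
    least [3 ^ (C - z)] units after [z] deletions, so [C - 1] deletions cannot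
    bring it below [3] units, up to a constant.  [tau2] is then chosen just
    below [3] units. *)

Require Import Defs.
From HB Require Import structures.
From mathcomp Require Import all_boot all_order all_algebra.
From mathcomp Require Import zify ring lra.
Import Order.TTheory GRing.Theory Num.Theory.
Local Open Scope ring_scope.

Set Implicit Arguments.
Unset Strict Implicit.
Unset Printing Implicit Defensive.

(** * Trees given by parent maps *)

Definition par_adj (V : finType) (par : V -> option V) : rel V :=
  [rel x y | (par x == Some y) || (par y == Some x)].

Definition par_ok (V : finType) (par : V -> option V) (rk : V -> nat) : Prop :=
  forall x y, par x = Some y -> (rk y < rk x)%N.

Lemma par_adj_sym (V : finType) (par : V -> option V) : symmetric (par_adj par).
Proof. by move=> x y; rewrite /par_adj /= orbC. Qed.

Lemma par_adj_irr (V : finType) (par : V -> option V) (rk : V -> nat) :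
  par_ok par rk -> irreflexive (par_adj par).
Proof.
by move=> ok x; apply/negP; rewrite /par_adj /= orbb => /eqP /ok; rewrite ltnn.
Qed.

Definition par_graph (V : finType) (par : V -> option V) (rk : V -> nat)
  (ok : par_ok par rk) : sgraph :=
  @SGraph V (par_adj par) (@par_adj_sym V par) (par_adj_irr ok).

(** Following parents lowers the rank until the root is reached, which gives connectedness. On a
    cycle, both neighbours of a vertex of maximal rank would be its parent, hence equal. *)
Lemma par_graph_tree (V : finType) (par : V -> option V) (rk : V -> nat)
    (ok : par_ok par rk) (root : V) :
  (forall x, par x = None -> x = root) -> is_tree (par_graph ok).
Proof.
move=> rootP; split.
- by apply/card_gt0P; exists root.
- have csym := sym_connect_sym (@par_adj_sym V par).
  suff cr (x : V) : connect (par_adj par) x root.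
    by move=> x y; apply: (connect_trans (cr x)); rewrite csym.
  have [m] := ubnP (rk x); elim: m => // m IH in x *; rewrite ltnS => lexm.
  case e: (par x) => [y|]; last by rewrite (rootP _ e) connect0.
  apply: (@connect_trans _ _ y); first by apply: connect1; rewrite /par_adj /= e eqxx.
  by apply: IH; apply: leq_trans (ok _ _ e) lexm.
- move=> s /andP[cs us]; rewrite leqNgt; apply/negP => s3.
  have [x0 x0s] : exists x, x \in s.
    by case: s s3 {cs us} => // x s _; exists x; rewrite inE eqxx.
  have [x xs xmax] := @arg_maxnP _ x0 (fun x => x \in s) rk x0s.
  have up (y : V) : y \in s -> par_adj par x y -> par x = Some y.
    move=> ys /orP[/eqP //|/eqP/ok]; rewrite ltnNge.
    by rewrite (xmax y ys : is_true (_ <= _)%N).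
  have e1 := up _ (etrans (mem_next s x) xs) (next_cycle cs xs).
  have e2 : par x = Some (prev s x).
    apply: up; first by rewrite mem_prev.
    by rewrite par_adj_sym; apply: prev_cycle.
  have e3 : next s x = prev s x by case: (etrans (esym e1) e2).
  have [i s' es] := rot_to xs.
  have us' : uniq (x :: s') by rewrite -es rot_uniq.
  have sz : (2 < size (x :: s'))%N by rewrite -es size_rot.
  move: e3; rewrite -(next_rot i us) -(prev_rot i us) es.
  (* In the rotated cycle [x :: y :: z :: s'] the successor of [x] is [y] and its predecessor lies
     in [z :: s'], against uniqueness. *)
  case: s' us' sz {es} => [//|y [//|z s']] us' _.
  have prev_in (p : seq V) (w : V) : prev_at x x w p \in w :: p.
    elim: p w => [|w2 p IH] w /=; first by rewrite eqxx inE.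
    by case: ifP => _; rewrite inE ?eqxx // IH orbT.
  move: us'; rewrite /= !inE !negb_or eqxx => /andP[/and3P[xy xz _]].
  move=> /and3P[/andP[yz ys] _ _]; rewrite (negPf xy) (negPf xz) => e.
  by have := prev_in s' z; rewrite -e inE (negPf yz) (negPf ys).
Qed.

Lemma big_option (R : Type) (idx : R) (op : Monoid.com_law idx) (T : finType)
    (f : option T -> R) :
  \big[op/idx]_x f x = op (f None) (\big[op/idx]_x f (Some x)).
Proof.
rewrite (bigD1 None) //=; congr (op _ _).
rewrite (reindex_omap Some id) /=; last by case.
by apply: eq_bigl => x; rewrite eqxx.
Qed.

Lemma par_graph_degree (V : finType) (par : V -> option V) (rk : V -> nat)
    (ok : par_ok par rk) (d : nat) :
  (forall x, (#|[set y | par y == Some x]| <= d)%N) ->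
  (max_degree (par_graph ok) <= d.+1)%N.
Proof.
move=> dP; apply/bigmax_leqP => x _.
have sub : [set y | par_adj par x y] \subset
    [set y | par x == Some y] :|: [set y | par y == Some x].
  by apply/subsetP => y; rewrite !inE.
apply: leq_trans (subset_leq_card sub) _.
apply: leq_trans (leq_card_setU _ _) _; rewrite -add1n; apply: leq_add (dP x).
case: (par x) => [y|]; last by rewrite (eq_card0 (A := _)) // => y; rewrite !inE.
rewrite (_ : [set _ | _] = [set y]) ?cards1 //.
by apply/setP => z; rewrite !inE eq_sym.
Qed.

Lemma bipartition_of_bool (G : sgraph) (col : G -> bool) (m1 m2 : nat) :
  (forall x y : G, adj x y -> col x != col y) ->
  (\sum_(x : G) col x)%N = m1 -> (\sum_(x : G) ~~ col x)%N = m2 ->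
  (m2 <= m1)%N -> bipartition_sizes G m1 m2.
Proof.
move=> colP s1 s2 le; exists [set x | col x]; split=> //.
- by move=> x y /colP; rewrite !inE.
- by rewrite -s1 -sum1_card big_mkcond; apply: eq_bigr => x _; rewrite inE; case: (col x).
- by rewrite -s2 -sum1_card big_mkcond; apply: eq_bigr => x _; rewrite !inE; case: (col x).
Qed.

Lemma sum_bool_negb (T : finType) (p : pred T) :
  (\sum_(x : T) p x + \sum_(x : T) ~~ p x)%N = #|T|.
Proof.
by rewrite -big_split -sum1_card; apply: eq_bigr => x _ /=; case: (p x).
Qed.

Lemma ramsey_lower_bound (G1 G2 : sgraph) (m : nat) :
  (forall N, (N < m)%N -> ~~ arrows N G1 G2) -> (m <= ramsey G1 G2)%N.
Proof.
move=> H; rewrite /ramsey; case: ex_minnP => N /andP[_ aN] _.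
by rewrite leqNgt; apply: contraTN aN; apply: H.
Qed.

(** * A level without deletions *)

(* [z j] is the number of deleted vertices at height [j]; the level is the
   smallest [L] with at most [L - p] deletions at heights up to [L]. *)
Lemma profile_level (z : nat -> nat) (k p : nat) :
  (\sum_(j < k.+1) z j + p <= k)%N ->
  exists L, [/\ (L <= k)%N, z L = 0%N &
    (3 ^ p + \sum_(j < L) 2 * 3 ^ j * z j <= 3 ^ L)%N].
Proof.
move=> hk; pose D L := (\sum_(j < L.+1) z j + p <= L)%N.
have [L DL minL] := @ex_minnP D (ex_intro _ k hk).
have Lk : (L <= k)%N by apply: minL.
(* By minimality of [L], the inequality defining [D] fails at [i - 1]. *)
have lo i : (i <= L)%N -> (i <= \sum_(j < i) z j + p)%N.
  case: i => // i iL; rewrite ltnNge; apply/negP => /minL; lia.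
(* In the induction, [lo] gives [3 ^ i <= 3 ^ (S + p)], and [1 + 2 * z i <= 3 ^ z i] absorbs the new
   term. *)
have X i : (i <= L)%N ->
    (3 ^ p + \sum_(j < i) 2 * 3 ^ j * z j <= 3 ^ (\sum_(j < i) z j + p))%N.
  elim: i => [|i IH] iL; first by rewrite !big_ord0 addn0.
  have := IH (ltnW iL); have := lo i (ltnW iL).
  rewrite !big_ord_recr /=.
  set S := (\sum_(j < i) z j)%N; set Y := (\sum_(j < i) _)%N => h1 h2.
  have h3 : (3 ^ i <= 3 ^ (S + p))%N by rewrite leq_exp2l.
  have h4 : (1 + 2 * z i <= 3 ^ z i)%N.
    elim: (z i) => // m IHm; rewrite expnS; lia.
  rewrite (_ : S + z i + p = S + p + z i)%N; last by lia.
  have h5 := leq_mul (leqnn (3 ^ (S + p))) h4.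
  have h6 := leq_mul h3 (leqnn (z i)).
  rewrite expnD; lia.
have := lo L (leqnn L); have := DL; rewrite /D big_ord_recr /= => h1 h2.
exists L; split=> //; first by lia.
have e : (\sum_(j < L) z j + p = L)%N.
  apply: anti_leq; rewrite h2 andbT; apply: leq_trans h1.
  by rewrite leq_add2r leq_addr.
by have := X L (leqnn L); rewrite e.
Qed.

(** * The ternary tree with caterpillars at its leaves *)

(* A caterpillar piece: spine vertices [(i, None)], each with [b.+1] leaves
   [(i, Some j)]; spine vertex [i.+1] hangs from the leaf [(i, Some ord0)].
   In the theorem [r = a.+1] and [rho = b.+1]. *)
Definition block (a b : nat) : finType := ('I_a.+1 * option 'I_b.+1)%type.

Fixpoint tvert (a b k : nat) : finType :=
  if k is k'.+1 then option ('I_3 * tvert a b k')%type else block a b.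

Definition block_par (a b : nat) (x : block a b) : option (block a b) :=
  match x with
  | (i, Some _) => Some (i, None)
  | (i, None) => if i == ord0 then None else Some (inord i.-1, Some ord0)
  end.

Fixpoint tpar (a b k : nat) : tvert a b k -> option (tvert a b k) :=
  match k with
  | 0 => @block_par a b
  | k'.+1 => fun x : option ('I_3 * tvert a b k') =>
      (* For a subtree root [v], [tpar v] is [None] and [omap] keeps it [None], which is now the new
         root. *)
      if x is Some (i, v) then Some (omap (pair i) (tpar v)) else None
  end.

Fixpoint trank (a b k : nat) : tvert a b k -> nat :=
  match k with
  | 0 => fun x : block a b => (2 * x.1 + isSome x.2)%N
  | k'.+1 => fun x : option ('I_3 * tvert a b k') =>
      if x is Some (i, v) then (trank v).+1 else 0%N
  end.

(** [true] is the larger class. A caterpillar is attached by a spine vertex, coloured [false], so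
    ternary vertices are coloured by the parity of their height. *)
Fixpoint tcol (a b k : nat) : tvert a b k -> bool :=
  match k with
  | 0 => fun x : block a b => isSome x.2
  | k'.+1 => fun x : option ('I_3 * tvert a b k') =>
      if x is Some (i, v) then tcol v else odd k'.+1
  end.

Fixpoint tlevel (a b k : nat) : tvert a b k -> nat :=
  match k with
  | 0 => fun _ : block a b => 0%N
  | k'.+1 => fun x : option ('I_3 * tvert a b k') =>
      if x is Some (i, v) then tlevel v else k'.+1
  end.

Definition troot (a b k : nat) : tvert a b k :=
  match k with
  | 0 => (ord0, None) : block a b
  | k'.+1 => None : option ('I_3 * tvert a b k')
  end.

Lemma tpar_root (a b k : nat) (x : tvert a b k) :
  (tpar x == None) = (x == troot a b k).
Proof.
apply/eqP/eqP; case: k x => [|k] /=; try by case=> [[i v]|].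
  by case=> i [j|] //=; case: eqP => // ->.
by case=> i [j|] //= [->]; rewrite eqxx.
Qed.

Lemma tpar_ok (a b k : nat) : par_ok (@tpar a b k) (@trank a b k).
Proof.
elim: k => [|k IH] /=.
  move=> [i [j|]] y /=; first by case=> <- /=; lia.
  case: eqP => // /eqP i0 [<-] /=.
  have ipos : (0 < i)%N by rewrite lt0n.
  rewrite inordK; last by have := ltn_ord i; lia.
  by lia.
case=> [[i v]|] // y [<-]; case e: (tpar v) => [w|] //=.
exact: IH e.
Qed.

Lemma tcol_root (a b k : nat) : tcol (troot a b k) = odd k.
Proof. by case: k. Qed.

Lemma tpar_col (a b k : nat) (x y : tvert a b k) :
  tpar x = Some y -> tcol x != tcol y.
Proof.
elim: k x y => [|k IH] /=.
  move=> [i [j|]] y /=; first by case=> <-.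
  by case: eqP => // _ [<-].
case=> [[i v]|] // y [<-]; case e: (tpar v) => [w|] /=; first exact: IH e.
move/eqP: e; rewrite tpar_root => /eqP->; rewrite tcol_root.
by case: (odd k).
Qed.

(** A spine vertex has [b.+1] children, a leaf of a caterpillar at most one, a ternary vertex
    three. *)
Lemma tpar_children (a b k : nat) (x : tvert a b k) :
  (#|[set y | tpar y == Some x]| <= b + 3)%N.
Proof.
elim: k x => [|k IH] /= x.
  case: x => i [j|].
    apply: (@leq_trans #|[set (inord i.+1, None) : block a b]|); last by rewrite cards1; lia.
    apply/subset_leq_card/subsetP => [[i' [j'|]]]; rewrite !inE => /eqP //=.
    case: eqP => // /eqP i0 [<- _]; apply/eqP; congr (_, _).
    have i'0 : (0 < i')%N by rewrite lt0n.
    have := ltn_ord i' => lti; apply/val_inj; rewrite /= !inordK ?prednK //.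
    1,2: exact: ltnW.
  have le : (#|@imset _ (block a b) (fun j => (i, Some j)) (mem 'I_b.+1)| <= b + 3)%N.
    by apply: leq_trans (leq_imset_card _ _) _; rewrite card_ord; lia.
  apply: leq_trans le.
  apply/subset_leq_card/subsetP => [[i' [j'|]]]; rewrite inE => /eqP //=.
    by case=> ->; apply: imset_f.
  by case: eqP.
case: x => [[i v]|].
  apply: leq_trans (IH v).
  apply: leq_trans (leq_imset_card (fun y => Some (i, y) : tvert a b k.+1) _).
  apply/subset_leq_card/subsetP => [[[i' y]|]]; rewrite inE => /eqP //= [].
  case e: (tpar y) => [w|] //= [-> ew].
  by apply: imset_f; rewrite inE e ew.
have le : (#|@imset _ (tvert a b k.+1) (fun i => Some (i, troot a b k)) (mem 'I_3)| <= b + 3)%N.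
  by apply: leq_trans (leq_imset_card _ _) _; rewrite card_ord; lia.
apply: leq_trans le.
apply/subset_leq_card/subsetP => [[[i' y]|]]; rewrite inE => /eqP //= [].
case e: (tpar y) => [w|] //= _.
by move/eqP: e; rewrite tpar_root => /eqP->; apply: imset_f.
Qed.

Definition tgraph (a b k : nat) : sgraph := par_graph (@tpar_ok a b k).

Lemma tgraph_tree (a b k : nat) : is_tree (tgraph a b k).
Proof.
apply: (@par_graph_tree _ _ _ _ (troot a b k)) => x /eqP.
by rewrite tpar_root => /eqP.
Qed.

Lemma tgraph_degree (a b k : nat) : (max_degree (tgraph a b k) <= b.+1 + 3)%N.
Proof. by rewrite addSn; apply/par_graph_degree/tpar_children. Qed.

Lemma tgraph_col (a b k : nat) (x y : tgraph a b k) :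
  adj x y -> tcol x != tcol y.
Proof. by case/orP=> /eqP /tpar_col; rewrite // eq_sym. Qed.

Lemma tsum (R : Type) (idx : R) (op : Monoid.com_law idx) (a b k : nat)
    (f : tvert a b k.+1 -> R) :
  \big[op/idx]_x f x = op (f None)
    (\big[op/idx]_(i < 3) \big[op/idx]_(v : tvert a b k) f (Some (i, v))).
Proof.
rewrite /= big_option pair_bigA /=; congr (op _ _).
by apply: eq_bigr => -[].
Qed.

Lemma tsum0 (R : Type) (idx : R) (op : Monoid.com_law idx) (a b : nat)
    (f : tvert a b 0 -> R) :
  \big[op/idx]_x f x = \big[op/idx]_(i < a.+1)
    op (f (i, None)) (\big[op/idx]_(j < b.+1) f (i, Some j)).
Proof.
rewrite /= (eq_bigr (fun i => \big[op/idx]_o f (i, o))); last first.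
  by move=> i _; rewrite big_option.
by rewrite pair_bigA /=; apply: eq_bigr => -[].
Qed.

(** Each of the [3 ^ k] caterpillars has [b.+1 * a.+1] leaves; [e] counts the ternary vertices at
    odd height. *)
Lemma tcount_large (a b k : nat) : exists2 e, (e < 3 ^ k)%N &
  (\sum_(x : tvert a b k) tcol x = 3 ^ k * (b.+1 * a.+1) + e)%N.
Proof.
elim: k => [|k [e lte IH]].
  exists 0%N => //; rewrite (tsum0 addn (fun x => nat_of_bool (tcol x))) /=.
  rewrite (eq_bigr (fun=> b.+1)) => [|i _]; last first.
    by rewrite sum_nat_const card_ord muln1.
  by rewrite sum_nat_const card_ord; lia.
exists (odd k.+1 + 3 * e)%N; first by rewrite expnS; case: odd => /=; lia.
rewrite (tsum addn (fun x => nat_of_bool (tcol x))) /= sum_nat_const card_ord IH expnS.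
by ring.
Qed.

Lemma tcount_small (a b k : nat) : exists2 e, (e < 3 ^ k)%N &
  (\sum_(x : tvert a b k) ~~ tcol x = 3 ^ k * a.+1 + e)%N.
Proof.
elim: k => [|k [e lte IH]].
  exists 0%N => //; rewrite (tsum0 addn (fun x => nat_of_bool (~~ tcol x))) /=.
  rewrite (eq_bigr (fun=> 1%N)) => [|i _]; last first.
    by rewrite sum_nat_const muln0.
  by rewrite sum_nat_const card_ord; lia.
exists (~~ odd k.+1 + 3 * e)%N; first by rewrite expnS; case: odd => /=; lia.
rewrite (tsum addn (fun x => nat_of_bool (~~ tcol x))) /= sum_nat_const card_ord IH expnS.
by ring.
Qed.

(** * Signings and their imbalance *)

Definition bsgn (c : bool) : int := if c then 1 else -1.

(* For a red copy, [s v] is the product of the signs of the colour class of [v]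
   and of the part receiving it, with [0] for the vertices sent to [Z]; it is
   constant on the components of what remains. *)
Definition signing (a b k : nat) (s : tvert a b k -> int) : Prop :=
  (forall v, `|s v| <= 1) /\
  (forall v w, tpar v = Some w -> [\/ s v = s w, s v = 0 | s w = 0]).

(** For a red copy this is the number of vertices sent to the first part minus the number sent to
    the second. *)
Definition imbalance (a b k : nat) (s : tvert a b k -> int) : int :=
  \sum_v bsgn (tcol v) * s v.

Definition zeros (a b k : nat) (s : tvert a b k -> int) : int :=
  \sum_v (s v == 0)%:R.

(** The difference [(rho - 1) * r] of the class sizes of one caterpillar. *)
Definition unit_imb (a b : nat) : int := b%:Z * a.+1%:Z.

Definition zeros_weight (a b k : nat) (L : nat) (s : tvert a b k -> int) : int :=
  \sum_v if (s v == 0) && (tlevel v < L)%N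
         then 2 * 3 ^+ tlevel v * (unit_imb a b + 1) else 0.

Lemma signing_sub (a b k : nat) (s : tvert a b k.+1 -> int) (i : 'I_3) :
  signing s -> signing (fun v : tvert a b k => s (Some (i, v))).
Proof.
move=> [s1 sE]; split=> [v|v w e]; first exact: s1.
by apply: sE; rewrite /= e.
Qed.

Lemma signing_root (a b k : nat) (s : tvert a b k.+1 -> int) (i : 'I_3) :
  signing s ->
  [\/ s (Some (i, troot a b k)) = s None, s (Some (i, troot a b k)) = 0 | s None = 0].
Proof.
move=> [_ sE]; apply: sE => /=.
by have /eqP -> : tpar (troot a b k) == None by rewrite tpar_root.
Qed.

Lemma signing1 (a b k : nat) : signing (fun _ : tvert a b k => 1).
Proof. by split=> // *; constructor 1. Qed.

Lemma imbalance_rec (a b k : nat) (s : tvert a b k.+1 -> int) :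
  imbalance s = bsgn (odd k.+1) * s None
    + \sum_(i < 3) imbalance (fun v : tvert a b k => s (Some (i, v))).
Proof. exact: (tsum +%R). Qed.

Lemma zeros_rec (a b k : nat) (s : tvert a b k.+1 -> int) :
  zeros s = (s None == 0)%:R
    + \sum_(i < 3) zeros (fun v : tvert a b k => s (Some (i, v))).
Proof. exact: (tsum +%R). Qed.

Lemma zeros_weight_rec (a b k L : nat) (s : tvert a b k.+1 -> int) :
  (L <= k.+1)%N || (s None != 0) -> zeros_weight L s =
    \sum_(i < 3) zeros_weight L (fun v : tvert a b k => s (Some (i, v))).
Proof.
move=> Lk; rewrite /zeros_weight (tsum +%R) /=.
by case/orP: Lk => [Lk|/negPf->]; rewrite ?ltnNge ?Lk ?andbF add0r.
Qed.

Lemma zeros_ge0 (a b k : nat) (s : tvert a b k -> int) : 0 <= zeros s.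
Proof. by apply: sumr_ge0. Qed.

Lemma unit_imb_ge0 (a b : nat) : 0 <= unit_imb a b.
Proof. by rewrite /unit_imb mulr_ge0. Qed.

(** A spine vertex of sign [c] with [z] deleted leaves contributes, with its leaves, [c * (b - z)];
    a deleted one leaves at most [b + 1], that is [b] plus one zero. *)
Lemma imbalance_block (a b : nat) (s : tvert a b 0 -> int) : (0 < b)%N ->
  signing s -> `|imbalance s| <= unit_imb a b + zeros s.
Proof.
move=> b0 [s1 sE]; rewrite /imbalance /zeros !(tsum0 +%R) /=.
have -> : unit_imb a b = \sum_(i < a.+1) b%:Z.
  by rewrite sumr_const card_ord /unit_imb -mulr_natr natz.
rewrite -big_split /=; apply: le_trans (ler_norm_sum _ _ _) _.
apply: ler_sum => i _.
set x := \sum_(j < b.+1) _; set z := \sum_(j < b.+1) _.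
have z0 : 0 <= z by apply: sumr_ge0.
have bE : b.+1%:Z = \sum_(j < b.+1) 1 by rewrite sumr_const card_ord natz.
have xb : `|x| <= b.+1%:Z.
  rewrite bE; apply: le_trans (ler_norm_sum _ _ _) _; apply: ler_sum => j _.
  by rewrite mul1r.
have zb : z <= b.+1%:Z by rewrite bE; apply: ler_sum => j _; case: eqP.
have [e|ne] := eqVneq (s (i, None)) 0.
  by rewrite e mulr0 add0r !natz; lia.
have -> : x = s (i, None) * (b.+1%:Z - z).
  rewrite bE /x /z -sumrB mulr_sumr; apply: eq_bigr => j _; rewrite mul1r.
  have [] := sE (i, Some j) (i, None) erefl; last by move/eqP: ne.
    by move->; rewrite (negPf ne) subr0 mulr1.
  by move->; rewrite eqxx subrr mulr0.
have : s (i, None) = 1 \/ s (i, None) = -1 by have := s1 (i, None); lia.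
by rewrite !natz; case=> ->; lia.
Qed.

(** The [1] added on the left is tripled by the recursion and so pays for the root. *)
Lemma imbalance_bound (a b k : nat) (s : tvert a b k -> int) : (0 < b)%N ->
  signing s -> `|imbalance s| + 1 <= 3 ^+ k * (unit_imb a b + 1) + zeros s.
Proof.
move=> b0; elim: k s => [|k IH] s ss.
  by have := imbalance_block b0 ss; rewrite expr0; lia.
have h i := IH _ (signing_sub i ss).
have [s1 _] := ss; have h0 := s1 None.
rewrite imbalance_rec zeros_rec.
have : `|\sum_(i < 3) imbalance (fun v : tvert a b k => s (Some (i, v)))| <=
   \sum_(i < 3) (3 ^+ k * (unit_imb a b + 1) - 1
     + zeros (fun v : tvert a b k => s (Some (i, v)))).
  apply: le_trans (ler_norm_sum _ _ _) _; apply: ler_sum => i _.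
  by have := h i; lia.
rewrite big_split /= sumr_const card_ord exprS.
have : `|bsgn (odd k.+1) * s None| <= 1 by rewrite /bsgn; case: ifP => _; lia.
have : 0 <= (s None == 0)%:R :> int by [].
set x := \sum_(i < 3) imbalance _; set y := \sum_(i < 3) zeros _.
set t := bsgn _ * _; set w := (_ == _)%:R; lia.
Qed.

Definition total_imb (a b k : nat) : int := imbalance (fun _ : tvert a b k => 1).

Lemma zeros1 (a b k : nat) : zeros (fun _ : tvert a b k => 1) = 0.
Proof. by rewrite /zeros big1. Qed.

Lemma total_imb_rec (a b k : nat) :
  total_imb a b k.+1 = bsgn (odd k.+1) + 3 * total_imb a b k.
Proof.
by rewrite /total_imb imbalance_rec mulr1 sumr_const card_ord mulr_natl.
Qed.

Lemma total_imb_lower (a b k : nat) :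
  3 ^+ k * (unit_imb a b - 1) + 1 <= total_imb a b k.
Proof.
elim: k => [|k IH].
  rewrite expr0 mul1r subrK /total_imb /imbalance (tsum0 +%R) /=.
  rewrite (eq_bigr (fun=> b%:Z)); last first.
    by move=> i _; rewrite /bsgn !mulr1 sumr_const card_ord; lia.
  by rewrite sumr_const card_ord /unit_imb -mulr_natr natz.
rewrite total_imb_rec exprS; have : -1 <= bsgn (odd k.+1) by rewrite /bsgn; case: ifP.
lia.
Qed.

Lemma signing_nonzero (a b k : nat) (s : tvert a b k -> int) :
  signing s -> (forall v, s v != 0) -> forall v, s v = s (troot a b k).
Proof.
move=> [_ sE] nz v; have [m] := ubnP (trank v); elim: m => // m IH in v *.
rewrite ltnS => le; case e: (tpar v) => [w|].
  have [->|/eqP|/eqP] := sE _ _ e; rewrite ?(negPf (nz _)) //.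
  by apply: IH; apply: leq_trans (tpar_ok e) le.
by move/eqP: e; rewrite tpar_root => /eqP->.
Qed.

Lemma tlevel_le (a b k : nat) (v : tvert a b k) : (tlevel v <= k)%N.
Proof. by elim: k v => [|k IH] //= [[i v]|] //; apply/leqW/IH. Qed.

Lemma tlevel_root (a b k : nat) : tlevel (troot a b k) = k.
Proof. by case: k. Qed.

Lemma zeros_weight_all (a b k L : nat) (s : tvert a b k -> int) : (k < L)%N ->
  zeros_weight L s =
    \sum_v if s v == 0 then 2 * 3 ^+ tlevel v * (unit_imb a b + 1) else 0.
Proof.
by move=> kL; apply: eq_bigr => v _; rewrite (leq_ltn_trans (tlevel_le v) kL) andbT.
Qed.

Lemma weight_ge1 (a b j : nat) : 1 <= 2 * 3 ^+ j * (unit_imb a b + 1).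
Proof.
have u0 := unit_imb_ge0 a b; have : 1 <= 3 ^+ j :> int by rewrite exprn_ege1.
nia.
Qed.

Lemma zeros_le_weight (a b k L : nat) (s : tvert a b k -> int) : (k < L)%N ->
  zeros s <= zeros_weight L s.
Proof.
move=> kL; rewrite zeros_weight_all //; apply: ler_sum => v _.
by case: eqP => // _; apply: weight_ge1.
Qed.

(** The root pays its full weight and every other zero at least 1; the [+ 1] is the root's own count
    in [zeros s]. *)
Lemma zeros_le_weight_root (a b k L : nat) (s : tvert a b k -> int) : (k < L)%N ->
  s (troot a b k) = 0 ->
  2 * 3 ^+ k * (unit_imb a b + 1) + zeros s <= zeros_weight L s + 1.
Proof.
move=> kL e; rewrite zeros_weight_all // /zeros.
rewrite (bigD1 (troot a b k)) //= [X in _ <= X + _](bigD1 (troot a b k)) //=.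
rewrite e eqxx tlevel_root -addrA lerD2l addrC lerD2r.
apply: ler_sum => v _; case: eqP => // _; exact: weight_ge1.
Qed.

(* A deleted root of a subtree of height [j] moves its contribution within
   [[- 3 ^ j, 3 ^ j]] units, hence the factor [2] in [zeros_weight]. *)
Lemma imbalance_effect (a b k L : nat) (s : tvert a b k -> int) : (0 < b)%N ->
  (k < L)%N -> signing s -> s (troot a b k) != 0 ->
  `|imbalance s - s (troot a b k) * total_imb a b k| <= zeros_weight L s.
Proof.
move=> b0; elim: k s => [|k IH] s kL ss s0.
  (* Without zeros the signing of a caterpillar is constant; one zero already weighs
     [2 * (unit_imb a b + 1)], which covers the gap between opposite extremes. *)
  have [/forallP nz|] := boolP [forall v, s v != 0].
    rewrite /total_imb /imbalance (eq_bigr (fun v => s (troot a b 0) * (bsgn (tcol v) * 1))).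
      rewrite -mulr_sumr subrr normr0; apply: le_trans (zeros_le_weight s kL).
      exact: zeros_ge0.
    by move=> v _; rewrite (signing_nonzero ss nz) mulr1 mulrC.
  rewrite negb_forall => /existsP[v]; rewrite negbK => /eqP v0.
  have h1 := imbalance_bound b0 ss.
  have := imbalance_bound b0 (signing1 a b 0).
  rewrite -/(total_imb a b 0) zeros1 => h2.
  have h3 : 2 * 3 ^+ 0 * (unit_imb a b + 1) + zeros s <= zeros_weight L s + 1.
    rewrite zeros_weight_all // /zeros.
    rewrite (bigD1 v) //= [X in _ <= X + _](bigD1 v) //=.
    rewrite v0 eqxx /= -addrA lerD2l addrC lerD2r.
    apply: ler_sum => w _; case: eqP => // _; exact: weight_ge1.
  have [s1 _] := ss; have := s1 (troot a b 0).
  move: h1 h2 h3; rewrite !expr0; move: (s _) s0 => c s0 h1 h2 h3 c1.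
  have : c = 1 \/ c = -1 by lia.
  by case=> ->; lia.
rewrite imbalance_rec total_imb_rec zeros_weight_rec; last by rewrite s0 orbT.
set c := s (troot a b k.+1) in s0 *; set x := \sum_(i < 3) imbalance _.
have -> : bsgn (odd k.+1) * s None + x - c * (bsgn (odd k.+1) + 3 * total_imb a b k)
    = x - 3 * (c * total_imb a b k) by rewrite -[s None]/c; ring.
have -> : 3 * (c * total_imb a b k) = \sum_(i < 3) c * total_imb a b k.
  by rewrite sumr_const card_ord mulr_natl.
rewrite /x -sumrB; apply: le_trans (ler_norm_sum _ _ _) _; apply: ler_sum => i _.
have si := signing_sub i ss; have kL' := ltnW kL.
have h1 := imbalance_bound b0 si.
have := imbalance_bound b0 (signing1 a b k); rewrite -/(total_imb a b k) zeros1 => h2.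
(* If the subtree's root is deleted, its weight covers the separate bounds on both imbalances;
   otherwise its sign is [c] and induction applies. *)
have [e|r0] := eqVneq (s (Some (i, troot a b k))) 0.
  have h3 := zeros_le_weight_root (s := fun v => s (Some (i, v))) kL' e.
  have [s1 _] := ss; have := s1 None; rewrite -[s None]/c => c1.
  have : c = 1 \/ c = -1 by lia.
  move: h1 h2 h3; move: (imbalance _) (total_imb _ _ _) (zeros _) (zeros_weight _ _).
  by move=> x1 x2 x3 x4 h1 h2 h3; case=> ->; lia.
have [e|e|e] := signing_root i ss; last by move: s0; rewrite /c /= e.
  by rewrite /c /= -e; apply: IH.
by move: r0; rewrite e.
Qed.

(** * Lower bound for the imbalance *)

Lemma sum_signs_odd (J : finType) (c : J -> int) : odd #|J| ->
  (forall j, c j = 1 \/ c j = -1) -> 1 <= `|\sum_j c j|.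
Proof.
move=> oJ c1.
have := sum_bool_negb (fun j => c j == 1); set m := (\sum_j _)%N; set m' := (\sum_j _)%N => mm.
have -> : \sum_j c j = m%:R - m'%:R.
  by rewrite !natr_sum -sumrB; apply: eq_bigr => j _; case: (c1 j) => ->.
by rewrite !natz; move: oJ; rewrite -mm; lia.
Qed.

(* An odd number of trees, because the root signs then have a nonzero sum; a
   level of roots is peeled off at each step, down to height [L]. *)
Lemma forest_imbalance (a b k L : nat) (J : finType)
    (s : J -> tvert a b k -> int) :
  (0 < b)%N -> odd #|J| -> (L <= k)%N -> (forall j, signing (s j)) ->
  (forall j v, tlevel v = L -> s j v != 0) ->
  total_imb a b L + #|J|%:Z <=
    `|\sum_j imbalance (s j)| + \sum_j zeros_weight L (s j) + #|J|%:Z * 3 ^+ k.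
Proof.
move=> b0; have base (J' : finType) (s' : J' -> tvert a b L -> int) : odd #|J'| ->
    (forall j, signing (s' j)) -> (forall j v, tlevel v = L -> s' j v != 0) ->
    total_imb a b L <= `|\sum_j imbalance (s' j)| + \sum_j zeros_weight L (s' j).
  move=> oJ ss nz; have r0 j : s' j (troot a b L) != 0 by rewrite nz ?tlevel_root.
  (* No zero lies at height [L], so the cutoff can be raised to [L.+1], as [imbalance_effect]
     requires. *)
  have wE j : zeros_weight L (s' j) = zeros_weight L.+1 (s' j).
    apply: eq_bigr => v _; have [e|ne] := eqVneq (tlevel v) L.
      by rewrite (negPf (nz _ _ e)).
    by rewrite ltnS [in RHS]leq_eqVlt (negPf ne).
  have c1 : 1 <= `|\sum_j s' j (troot a b L)|.
    apply: sum_signs_odd => // j; have [s1 _] := ss j.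
    by have := s1 (troot a b L); have := r0 j; lia.
  have : `|\sum_j (imbalance (s' j) - s' j (troot a b L) * total_imb a b L)|
      <= \sum_j zeros_weight L (s' j).
    apply: le_trans (ler_norm_sum _ _ _) _; apply: ler_sum => j _.
    by rewrite wE; apply: imbalance_effect.
  rewrite sumrB -mulr_suml.
  have i0 : 0 <= total_imb a b L.
    apply: le_trans (total_imb_lower a b L); rewrite addr_ge0 // mulr_ge0 ?exprn_ge0 //.
    by rewrite /unit_imb; nia.
  move: c1 i0; move: (\sum_j s' j _) (total_imb _ _ _) (\sum_j imbalance _).
  move=> c I F; move: (\sum_j _) => W c1 I0 h.
  have : I <= `|c * I| by rewrite normrM (ger0_norm I0); apply: ler_peMl.
  lia.
elim: k J s => [|k IH] J s oJ.
  rewrite leqn0 => /eqP L0 ss nz; subst L.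
  by rewrite expr0 mulr1 lerD2r; apply: base.
rewrite leq_eqVlt => /predU1P[Lk|Lk] ss nz.
  subst L; apply: lerD; first exact: base.
  by rewrite ler_peMr // exprn_ege1.
(* The [3 * #|J|] subtrees are again odd in number; dropping the roots changes the sum by at most
   [#|J|], which the term [3 * #|J|] on the left absorbs. *)
pose s' (p : J * 'I_3) := fun v : tvert a b k => s p.1 (Some (p.2, v)).
have := IH _ s'; rewrite card_prod card_ord oddM oJ => /(_ isT Lk).
have -> : \sum_p imbalance (s' p) =
    \sum_j imbalance (s j) - \sum_j bsgn (odd k.+1) * s j None.
  rewrite -sumrB -(pair_bigA _ (fun j i => imbalance (s' (j, i)))) /=.
  by apply: eq_bigr => j _; rewrite imbalance_rec addrC addKr.
have -> : \sum_p zeros_weight L (s' p) = \sum_j zeros_weight L (s j).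
  rewrite -(pair_bigA _ (fun j i => zeros_weight L (s' (j, i)))) /=.
  by apply: eq_bigr => j _; rewrite zeros_weight_rec // ltnW.
have : `|\sum_j bsgn (odd k.+1) * s j None| <= #|J|%:Z.
  have -> : #|J|%:Z = \sum_(j : J) 1 by rewrite sumr_const natz.
  apply: le_trans (ler_norm_sum _ _ _) _; apply: ler_sum => j _.
  by have [s1 _] := ss j; have := s1 None; rewrite /bsgn; case: ifP => _; lia.
move: (\sum_j imbalance _) (\sum_j bsgn _ * _) (\sum_j zeros_weight _ _).
move=> F e W he h; have {h} := h (fun p => signing_sub p.2 (ss p.1)).
rewrite exprS => /(_ (fun p v e => nz p.1 (Some (p.2, v)) e)); lia.
Qed.

(** Fewer than [k] zeros allow [p = 1] in [profile_level], so three units survive. The error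
    [3 ^+ k.+1] is at most [2 * 3 ^ L] from [total_imb_lower] plus [3 ^ k] for the vertices above
    height [L]. *)
Lemma imbalance_lower (a b k : nat) (s : tvert a b k -> int) :
  (0 < b)%N -> signing s -> (\sum_v (s v == 0) < k)%N ->
  3 * (unit_imb a b + 1) <= `|imbalance s| + 3 ^+ k.+1.
Proof.
move=> b0 ss zk; pose z j := (\sum_v ((s v == 0) && (tlevel v == j)))%N.
have zsum : (\sum_(j < k.+1) z j = \sum_v (s v == 0))%N.
  rewrite /z exchange_big; apply: eq_bigr => v _ /=.
  rewrite (bigD1 (inord (tlevel v))) //= inordK ?ltnS ?tlevel_le // eqxx andbT.
  rewrite big1 ?addn0 // => i ne; case: eqP => // _; case: eqP => // e.
  by case/eqP: ne; rewrite e inord_val.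
have [|L [Lk zL hL]] := @profile_level z k 1; first by rewrite zsum addn1.
have := @forest_imbalance a b k L unit (fun=> s) b0.
rewrite card_unit !(big_pred1 tt) /=; try by case.
move=> /(_ isT Lk (fun=> ss)).
have nz v : tlevel v = L -> s v != 0.
  move=> e; apply/negP => sv; move: zL; rewrite /z (bigD1 v) //=.
  by rewrite sv e eqxx.
move=> /(_ (fun=> nz)).
have -> : zeros_weight L s =
    (\sum_(j < L) 2 * 3 ^ j * z j)%N%:R * (unit_imb a b + 1).
  rewrite natr_sum mulr_suml /zeros_weight.
  rewrite (eq_bigr (fun v => \sum_(j < L)
     2 * 3 ^+ j * ((s v == 0) && (tlevel v == j))%:R * (unit_imb a b + 1))).
    rewrite exchange_big; apply: eq_bigr => j _.
    by rewrite -mulr_suml -mulr_sumr !natrM natrX /z natr_sum.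
  move=> v _; case: (s v == 0) => /=; last first.
    by rewrite big1 // => j _; rewrite mulr0 mul0r.
  case: ltnP => lt.
    rewrite (bigD1 (Ordinal lt)) //= eqxx mulr1 big1 ?addr0 // => j ne.
    rewrite (_ : (_ == _ :> nat) = false) ?mulr0 ?mul0r //.
    by apply: contra_neqF ne => /eqP e; apply: val_inj.
  rewrite big1 // => j _; rewrite (_ : (_ == _ :> nat) = false) ?mulr0 ?mul0r //.
  by have := ltn_ord j; lia.
have := total_imb_lower a b L; have u0 := unit_imb_ge0 a b.
have : (3 ^ L <= 3 ^ k)%N by rewrite leq_exp2l.
have pow n : 3 ^+ n = (3 ^ n)%N%:Z :> int by rewrite -natz natrX.
move: hL; rewrite exprS !pow natz.
move: (total_imb _ _ _) (imbalance s) (unit_imb a b) u0 => I F u u0.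
move: (\sum_(j < L) _)%N (3 ^ L)%N (3 ^ k)%N => S p q h1 h2 h3.
have h4 : 0 <= (p%:Z - 3 - S%:Z) * (u + 1) by apply: mulr_ge0; lia.
lia.
Qed.

(** * The tree with prescribed class sizes *)

(* A tree with prescribed class sizes and balanced degrees: [inr i] hangs from
   [inl (i mod b.+1)], and [inl j.+1] hangs from [inr j]. *)
Definition cat_vert (a b : nat) : finType := ('I_b.+1 + 'I_a.+1)%type.

Definition cat_par (a b : nat) (x : cat_vert a b) : option (cat_vert a b) :=
  match x with
  | inl j => if j == ord0 then None else Some (inr (inord j.-1))
  | inr i => Some (inl (inord (i %% b.+1)))
  end.

Definition cat_rank (a b : nat) (x : cat_vert a b) : nat :=
  match x with inl j => 2 * j | inr i => 2 * (i %% b.+1) + 1 end.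

Lemma cat_par_ok (a b : nat) : (b <= a)%N -> par_ok (@cat_par a b) (@cat_rank a b).
Proof.
move=> ba [j|i] y /=; last first.
  by case=> <- /=; rewrite inordK ?ltn_pmod // addn1.
case: eqP => // /eqP j0 [<-] /=; have jb := ltn_ord j.
have jpos : (0 < j)%N by rewrite lt0n.
rewrite inordK; last by lia.
by rewrite modn_small; lia.
Qed.

(** The children [inr i] of [inl j] have the same residue modulo [b.+1], so their quotients, all
    below [D], tell them apart. The only possible child of [inr i] is [inl i.+1]. *)
Lemma cat_children (a b D : nat) (x : cat_vert a b) :
  (b <= a)%N -> (a < D * b.+1)%N -> (#|[set y | cat_par y == Some x]| <= D)%N.
Proof.
move=> ba aD; case: x => [j|i].
  have lt (i : 'I_a.+1) : (i %/ b.+1 < D)%N.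
    by rewrite ltn_divLR //; have := ltn_ord i; lia.
  have h : {in [set i : 'I_a.+1 | (i %% b.+1 == j)%N] &,
      injective (fun i => Ordinal (lt i))}.
    move=> i i'; rewrite !inE => /eqP e /eqP e' [q].
    by apply: val_inj; rewrite /= (divn_eq i b.+1) (divn_eq i' b.+1) q e e'.
  apply: (@leq_trans #|[set i : 'I_a.+1 | (i %% b.+1 == j)%N]|); last first.
    by rewrite -(card_in_imset h) -[X in (_ <= X)%N]card_ord max_card.
  apply: leq_trans (leq_imset_card (fun i => inr i : cat_vert a b) _).
  apply/subset_leq_card/subsetP => -[j'|i]; rewrite inE => /eqP /=.
    by case: eqP.
  case=> <-; apply: imset_f; rewrite inE inordK ?ltn_pmod //.
apply: (@leq_trans 1); last by lia.
have [le|lt] := leqP b i.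
  rewrite (_ : [set _ | _] = set0) ?cards0 //; apply/setP => -[j|i'];
    rewrite !inE; apply/eqP => //=.
  case: eqP => // /eqP j0 [/(congr1 val)] /=.
  have jpos : (0 < j)%N by rewrite lt0n.
  have jb := ltn_ord j; rewrite inordK; last by lia.
  by move: le jpos jb => /=; lia.
rewrite -(cards1 (inl (inord i.+1) : cat_vert a b)).
apply/subset_leq_card/subsetP => -[j|i']; rewrite !inE => /eqP //=.
case: eqP => // /eqP j0 [/(congr1 val)] /=.
have jpos : (0 < j)%N by rewrite lt0n.
have jb := ltn_ord j; rewrite inordK; last by lia.
by move=> <-; rewrite prednK //; apply/eqP; congr inl; apply: val_inj; rewrite /= inordK.
Qed.

Definition cat_graph (a b : nat) (ba : (b <= a)%N) : sgraph :=
  par_graph (cat_par_ok ba).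

Lemma cat_graph_tree (a b : nat) (ba : (b <= a)%N) : is_tree (cat_graph ba).
Proof.
apply: (@par_graph_tree _ _ _ _ (inl ord0)) => -[j|i] //=.
by case: eqP => // ->.
Qed.

Lemma cat_graph_degree (a b D : nat) (ba : (b <= a)%N) : (a < D * b.+1)%N ->
  (max_degree (cat_graph ba) <= D.+1)%N.
Proof. by move=> aD; apply: par_graph_degree => x; apply: cat_children. Qed.

Lemma cat_graph_bipartition (a b : nat) (ba : (b <= a)%N) :
  bipartition_sizes (cat_graph ba) a.+1 b.+1.
Proof.
pose col (x : cat_vert a b) := if x is inr _ then true else false.
have adjC (x y : cat_vert a b) : cat_par x = Some y -> col x != col y.
  case: x => [j|i] /=; last by case=> <-.
  by case: eqP => // _ [<-].
apply: (@bipartition_of_bool (cat_graph ba) col) => //.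
- by move=> x y /orP[] /eqP /adjC; rewrite // eq_sym.
- by rewrite big_sumType /= !sum_nat_const !card_ord muln0 muln1.
- by rewrite big_sumType /= !sum_nat_const !card_ord muln0 muln1 addn0.
Qed.

Lemma card_cat_graph (a b : nat) (ba : (b <= a)%N) :
  #|cat_graph ba| = (a.+1 + b.+1)%N.
Proof. by rewrite /= card_sum !card_ord addnC. Qed.

(** * The three-part colouring *)

Lemma card_ord_range (N m d : nat) : (#|[set x : 'I_N | m <= x < m + d]| <= d)%N.
Proof.
rewrite cardE -(size_map val) -[X in (_ <= X)%N](size_iota m).
apply: uniq_leq_size.
  by rewrite map_inj_uniq ?enum_uniq //; apply: val_inj.
by move=> y /mapP[x]; rewrite mem_enum inE => h ->; rewrite mem_iota.
Qed.

Definition part (nu x : nat) : nat :=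
  if (x < nu.-1)%N then 0 else if (x < 2 * nu.-1)%N then 1 else 2.

Lemma card_part (N nu z i : nat) : (N <= 2 * nu.-1 + z)%N ->
  (#|[set x : 'I_N | part nu x == i]| <= (if (i < 2)%N then nu.-1 else z))%N.
Proof.
move=> Nle; set m := nu.-1 in Nle *; set d := (if _ then _ else _).
apply: leq_trans (card_ord_range N (m * i) d).
apply/subset_leq_card/subsetP => x; rewrite {}/d !inE /part -/m => /eqP <-.
have xN := ltn_ord x.
case: (ltnP x m) => h1 /=; first by rewrite muln0 add0n leq0n h1.
by case: (ltnP x (2 * m)%N) => h2 /=; [lia | move: Nle; lia].
Qed.

(** A blue copy of the connected [S] would lie in one part, which is too small; a red copy of [T]
    followed by [part] is a map [g] as excluded. *)
Lemma not_arrows_parts (T S : sgraph) (z N : nat) :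
  is_tree S -> (z < #|S|)%N -> (N <= 2 * #|S|.-1 + z)%N ->
  (forall g : T -> nat, (forall x y, adj x y -> g x <> g y) ->
     (forall i, (#|[set x | g x == i]| <= if (i < 2)%N then #|S|.-1 else z)%N) ->
     (forall x, (g x <= 2)%N) -> False) ->
  ~~ arrows N T S.
Proof.
move=> [S0 Sconn _] zS Nle noT; set nu := #|S| in S0 zS Nle noT.
pose c := [ffun p : 'I_N * 'I_N => part nu p.1 != part nu p.2].
apply/negP => /forallP /(_ c) /implyP arr.
have csym : [forall x, forall y, c (x, y) == c (y, x)].
  by apply/forallP => x; apply/forallP => y; rewrite !ffunE /= (eq_sym (part nu x)).
case/orP: (arr csym) => {arr csym}.
  case/existsP => f /andP[/injectiveP finj /forallP fP].
  apply: (noT (fun x => part nu (f x))) => [x y xy|i|x].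
  - have /forallP/(_ y)/implyP/(_ xy) := fP x.
    by rewrite /= ffunE /= => /eqP.
  - apply: leq_trans (card_part i Nle); rewrite -(card_imset _ finj).
    by apply/subset_leq_card/subsetP => _ /imsetP[x xi ->]; move: xi; rewrite !inE.
  - by rewrite /part; case: ifP => // _; case: ifP.
case/existsP => f /andP[/injectiveP finj /forallP fP].
have /card_gt0P[x0 _] := S0.
have same x : part nu (f x) = part nu (f x0).
  have /connectP[p pP ->] := Sconn x0 x; elim: p x0 pP => [//|y p IH] x0 /=.
  case/andP=> xy /IH ->; have /forallP/(_ y)/implyP/(_ xy) := fP x0.
  by rewrite /= ffunE negbK => /eqP.
have := card_part (part nu (f x0)) Nle; apply/negP; rewrite -ltnNge.
apply: (@leq_trans nu); first by case: ifP => //; rewrite prednK.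
rewrite [X in (X <= _)%N](_ : nu = #|[set: S]|) ?cardsT // -cardsT -(card_imset _ finj).
by apply/subset_leq_card/subsetP => _ /imsetP[x _ ->]; rewrite inE same.
Qed.

(** The first two parts hold at most [2 * m] vertices minus their difference, which
    [imbalance_lower] bounds from below. *)
Lemma tgraph_parts (a b k m : nat) (g : tgraph a b k -> nat) :
  (0 < b)%N ->
  (forall x y, adj x y -> g x <> g y) -> (forall x, g x <= 2)%N ->
  (#|[set x | g x == 0]| <= m)%N -> (#|[set x | g x == 1]| <= m)%N ->
  (#|[set x | g x == 2]| < k)%N ->
  (#|tgraph a b k| + 3 * (b * a.+1 + 1) < 2 * m + k + 3 ^ k.+1)%N.
Proof.
move=> b0 gadj g2.
have cardE i : #|[set x | g x == i]| = (\sum_(x : tvert a b k) (g x == i))%N.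
  by rewrite -sum1_card big_mkcond; apply: eq_bigr => x _; rewrite inE; case: eqP.
rewrite !cardE => m0 m1 m2.
pose s (x : tvert a b k) : int :=
  if g x == 0%N then bsgn (tcol x) else if g x == 1%N then - bsgn (tcol x) else 0.
have ss : signing s.
  split=> [v|v w e].
    by rewrite /s /bsgn; case: (tcol v); case: (g v) => [|[|]].
  (* Adjacent vertices outside the third part differ both in part and in class, so the two sign
     changes cancel. *)
  have /gadj ne : par_adj (@tpar a b k) v w by rewrite /par_adj /= e eqxx.
  have := tpar_col e; rewrite /s => tne.
  have := g2 w; have := g2 v; move: ne tne; rewrite /bsgn.
  case: (g v) => [|[|[|//]]]; case: (g w) => [|[|[|//]]] //= ne tne _ _;
    by [constructor 1; move: tne; do 2 case: tcol | constructor 2 | constructor 3].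
have z2 : (\sum_v (s v == 0) = \sum_(x : tvert a b k) (g x == 2))%N.
  apply: eq_bigr => v _; rewrite /s; have := g2 v.
  by case: (g v) => [|[|[|//]]] _ //=; case: tcol.
have := imbalance_lower b0 ss; rewrite z2 => /(_ m2).
have -> : imbalance s = (\sum_(x : tvert a b k) (g x == 0))%N%:R
    - (\sum_(x : tvert a b k) (g x == 1))%N%:R.
  rewrite !natr_sum -sumrB; apply: eq_bigr => v _; rewrite /s.
  by have := g2 v; case: (g v) => [|[|[|//]]] _ //=; case: tcol.
have -> : #|tgraph a b k| = (\sum_(x : tvert a b k) (g x == 0)
    + \sum_(x : tvert a b k) (g x == 1) + \sum_(x : tvert a b k) (g x == 2))%N.
  rewrite -!big_split -sum1_card; apply: eq_bigr => v _ /=.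
  by have := g2 v; case: (g v) => [|[|[|//]]].
have -> : 3 ^+ k.+1 = (3 ^ k.+1)%N%:Z :> int by rewrite -natz natrX.
move: m0 m1 m2; rewrite !natz /unit_imb.
move: (\sum_x _)%N (\sum_x _)%N (\sum_x _)%N (3 ^ _)%N => x0 x1 x2 p; lia.
Qed.

(** * Choice of sizes and conclusion *)

(** [d] corrects the parity of [n - tau2]. The last equation says [2 * nu = n + tau2] for
    [nu = tau1 + tau2]. *)
Lemma class_sizes (u n q : nat) : (q < 3 * u)%N -> (3 * u <= n)%N ->
  exists d tau1 tau2 : nat, [/\ (d <= 1)%N, (tau2 + (q + d) = 3 * u)%N &
    (2 * tau1 + tau2 = n)%N].
Proof.
move=> qu un; pose d : nat := odd (n + 3 * u + q).
exists d, ((n - (3 * u - (q + d)))./2)%N, (3 * u - (q + d))%N.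
have d1 : (d <= 1)%N by rewrite /d; case: odd.
have ev : ~~ odd (n + 3 * u + q + d) by rewrite oddD /d oddb addbb.
by move: d1 ev; move: d => d d1 ev; split; lia.
Qed.

Theorem theorem1p5 (C : nat) (hC : (2 <= C)%N) :
  exists K r0 : nat, forall r rho : nat, (r0 <= r)%N -> (2 <= rho)%N ->
  exists (T S : sgraph) (n t1 t2 nu tau1 tau2 : nat),
    [/\ is_tree T /\ is_tree S,
        (max_degree T <= rho + 3)%N /\ (max_degree S <= 3 ^ (C + 1) + 2)%N,
        [/\ #|T| = n, bipartition_sizes T t1 t2,
            `|t1%:R - 3 ^+ C * rho%:R * r%:R| <= K%:R :> rat &
            `|t2%:R - 3 ^+ C * r%:R| <= K%:R :> rat],
        [/\ #|S| = nu /\ bipartition_sizes S tau1 tau2, (nu <= n)%N,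
            `|tau1%:R - ((3 ^+ C - 3) * rho%:R * r%:R
                         + (3 ^+ C + 3) * r%:R) / 2| <= K%:R :> rat,
            `|tau2%:R - 3 * (rho%:R - 1) * r%:R| <= K%:R :> rat &
            (2 * nu = n + tau2)%N /\ (n + tau2 < 2 * t1)%N] &
        (2 * nu + C - 2 <= ramsey T S)%N /\
        (2 * nu + C - 2 = ramsey_lower n t1 t2 nu tau1 tau2 + C - 1)%N].
Proof.
pose p := (3 ^ C)%N; have p9 : (9 <= p)%N by rewrite (@leq_exp2l 3 2).
(* The first witness bounds [e1 + e2 + 3 * p + C + d], with [e1, e2 < p] and [d <= 1]. *)
exists (5 * p + C + 1)%N, (3 * p + C + 20)%N => -[|a] [|b] ra rho2; [lia|lia|by []|].
have b0 : (0 < b)%N by [].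
have [e1 e1p n1E] := tcount_large a b C; have [e2 e2p n2E] := tcount_small a b C.
rewrite -/p in e1p n1E e2p n2E.
set n1 := (\sum_(x : tvert a b C) tcol x)%N in n1E.
set n2 := (\sum_(x : tvert a b C) ~~ tcol x)%N in n2E.
have nE : (n1 + n2)%N = #|tgraph a b C| by apply: sum_bool_negb.
have uE : (b.+1 * a.+1 = b * a.+1 + a.+1)%N by rewrite mulSn addnC.
rewrite uE mulnDr in n1E; set u := (b * a.+1)%N in uE n1E.
have ru : (a.+1 <= u)%N by rewrite leq_pmull.
have pu9 : (9 * u <= p * u)%N by rewrite leq_mul2r p9 orbT.
have pru : (p * a.+1 <= p * u)%N by rewrite leq_mul2l ru orbT.
have pr9 : (9 * a.+1 <= p * a.+1)%N by rewrite leq_mul2r p9 orbT.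
(* [3 * p] is the error in [imbalance_lower], and [C] makes up for the vertices in [Z]. *)
have [||d [tau1 [tau2 [d1 tau2E tau1E]]]] := @class_sizes u (n1 + n2) (3 * p + C).
- by lia.
- by lia.
have tau20 : (0 < tau2)%N by lia.
have tau21 : (tau2 <= tau1)%N by lia.
(* This ratio gives the degree bound for the second tree; it follows from [2 * tau1 <= n] and
   [n <= p * (u + 2 * a.+1 + 2)]. *)
have tauD : (tau1 <= 3 ^ C.+1 * tau2)%N.
  have h : (p * (u + 2 * a.+1 + 2) <= p * (6 * tau2))%N.
    by rewrite leq_mul2l; apply/orP; right; lia.
  by rewrite expnS -/p -mulnA mulnCA mulnC; move: h; rewrite !mulnDr; lia.
case: tau1 tau2 tau20 tau21 tauD tau1E tau2E => [|t1] [|t2] // _ t21 tD t1E t2E.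
exists (tgraph a b C), (cat_graph (a := t1) (b := t2) t21), (n1 + n2)%N, n1, n2,
  (t1.+1 + t2.+1)%N, t1.+1, t2.+1.
have toR (x y : nat) : x = y -> x%:R = y%:R :> rat by move->.
have pR : p%:R = 3 ^+ C :> rat by rewrite natrX.
have n1R : n1%:R = 3 ^+ C * b.+1%:R * a.+1%:R + e1%:R :> rat.
  by rewrite -pR -!natrM -natrD; apply: toR; rewrite -mulnA uE mulnDr.
have n2R : n2%:R = 3 ^+ C * a.+1%:R + e2%:R :> rat.
  by rewrite -pR -!natrM -natrD; apply: toR.
have t2R : t2.+1%:R + (3 * p%:R + C%:R + d%:R) = 3 * (b.+1%:R - 1) * a.+1%:R :> rat.
  rewrite -[b.+1]addn1 natrD addrK -!(natrM, natrD).
  by apply: toR; rewrite -mulnA.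
have t1R : 2 * t1.+1%:R + t2.+1%:R = n1%:R + n2%:R :> rat.
  by rewrite -!(natrM, natrD); apply: toR.
have err (x y : rat) (m : nat) :
    x = y + m%:R \/ y = x + m%:R -> (m <= 5 * p + C + 1)%N ->
    `|x - y| <= (5 * p + C + 1)%N%:R.
  by case=> -> le; rewrite ?(addrC y) ?addrK ?opprD ?addrA ?subrr ?add0r ?normrN
    normr_nat ler_nat.
split.
- by split; [exact: tgraph_tree | exact: cat_graph_tree].
- split; first exact: tgraph_degree.
  apply: (@leq_trans (3 ^ C.+1).+1); last by rewrite addn1 addn2.
  exact: cat_graph_degree.
- split=> //.
  + by apply: bipartition_of_bool (@tgraph_col a b C) _ _ _ => //; lia.
  + by apply: (err _ _ e1); [left | lia].
  + by apply: (err _ _ e2); [left | lia].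
- split; [split; [exact: card_cat_graph | exact: cat_graph_bipartition] | lia | | |].
  + rewrite (_ : _ - _ = (e1 + e2 + 3 * p + C + d)%N%:R / 2).
      rewrite ger0_norm ?divr_ge0 // ler_pdivrMr // -natrM ler_nat; lia.
    by rewrite !natrD; move: t1R t2R n1R n2R; rewrite pR; lra.
  + by apply: (err _ _ (3 * p + C + d)%N); [right; rewrite -t2R !natrD; ring | lia].
  + by split; lia.
split; last first.
  (* The maximum is [2 * nu]: it equals [n + tau2], and no other term exceeds it. *)
  rewrite /ramsey_lower; lia.
apply: ramsey_lower_bound => N ltN.
apply: (@not_arrows_parts _ _ C.-1); rewrite ?card_cat_graph.
- exact: cat_graph_tree.
- by lia.
- by lia.
move=> g gadj gc g2.
(* With [m = nu - 1], the bound would give [3 * u + 3 < 3 * u - d - 2]. *)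
have := @tgraph_parts a b C (t1.+1 + t2.+1).-1 g b0 gadj g2 (gc 0%N) (gc 1%N).
have := gc 2%N; rewrite -nE -/u expnS -/p /=; lia.
Qed.
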